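(* Let $G$ be a metrizable NSS topological group and let $X$ be a $G^\star$-regular space. Then $X$ is compact if and only if $C_p(X,G)$ is a TAP group of countable tightness.
   Context: All spaces are Tychonoff and non-empty; all topological groups are Hausdorff, $e$ is the identity of $G$. $C_p(X,G)$ is the group of all continuous maps $X\to G$ with pointwise group operations and the topology of pointwise convergence. $X$ is $G^\star$-regular if there exists $g\in G\setminus\{e\}$ such that for every closed $F\subseteq X$ and every $x\in X\setminus F$ there is $f\in C_p(X,G)$ with $f(x)=g$ and $f(F)\subseteq\{e\}$. A topological group is NSS if some open neighborhood of the identity contains no nontrivial subgroup. A subset $A$ of a topological group $H$ is absolutely productive in $H$ if for every injection $a:\mathbb{N}\to A$ and every map $z:\mathbb{N}\to\mathbb{Z}$ the sequence $\left(\prod_{n=0}^{k}a(n)^{z(n)}\right)_{k\in\mathbb{N}}$ converges in $H$; $H$ is TAP if every absolutely productive subset of $H$ is finite. *)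

(* Defs.v *)
From HB Require Import structures.
From mathcomp Require Import all_boot all_order all_algebra.
From mathcomp Require Import all_classical all_reals all_analysis.
From mathcomp Require Import Rstruct Rstruct_topology.
Set Implicit Arguments. Unset Strict Implicit. Unset Printing Implicit Defensive.
Import Order.TTheory GRing.Theory Num.Theory.
Local Open Scope classical_set_scope.
Local Open Scope ring_scope.

Notation Rr := Rdefinitions.R.

Definition is_topological_group (G : topologicalType)
  (mul : G -> G -> G) (inv : G -> G) (e : G) : Prop :=
  [/\ (forall x y z, mul x (mul y z) = mul (mul x y) z),
      (forall x, mul e x = x /\ mul x e = x),
      (forall x, mul (inv x) x = e /\ mul x (inv x) = e),
      continuous (fun p : G * G => mul p.1 p.2) &
      continuous inv].

Definition metrizable (T : topologicalType) : Prop :=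
  exists d : T -> T -> Rr,
    [/\ (forall x y, 0 <= d x y),
        (forall x y, d x y = 0 <-> x = y),
        (forall x y, d x y = d y x),
        (forall x y z, d x z <= d x y + d y z) &
        (forall (x : T) (A : set T),
            nbhs x A <-> exists2 eps : Rr, 0 < eps & [set y | d x y < eps] `<=` A)].

Definition is_subgroup (G : Type) (mul : G -> G -> G) (inv : G -> G) (e : G)
  (H : set G) : Prop :=
  [/\ H e, (forall x y, H x -> H y -> H (mul x y)) & (forall x, H x -> H (inv x))].

Definition NSS (G : topologicalType) (mul : G -> G -> G) (inv : G -> G) (e : G)
  : Prop :=
  exists U : set G, [/\ open U, U e &
    forall H : set G, is_subgroup mul inv e H -> H `<=` U -> H = [set e]].

Definition tychonoff_space (X : topologicalType) : Prop :=
  hausdorff_space X /\ completely_regular_space X.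

Definition Gstar_regular (G : topologicalType) (e : G) (X : topologicalType)
  : Prop :=
  exists2 g : G, g <> e &
    forall (F : set X) (x : X), closed F -> ~ F x ->
      exists f : X -> G, [/\ continuous f, f x = g & f @` F `<=` [set e]].

Definition Cp_set (X G : topologicalType) : set {ptws X -> G} :=
  [set f | continuous (f : X -> G)].
Arguments Cp_set : clear implicits.

(** C_p(X,G) as a topological space: the subspace topology on [Cp_set X G]
    (for points of [Cp_set X G], which are the only ones we use). *)
Definition Cp_space (X G : topologicalType) : topologicalType :=
  subspace (Cp_set X G).
Arguments Cp_space : clear implicits.

Definition ptmul (X G : Type) (mul : G -> G -> G) (f g : X -> G) : X -> G :=
  fun x => mul (f x) (g x).
Definition ptinv (X G : Type) (inv : G -> G) (f : X -> G) : X -> G :=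
  fun x => inv (f x).
Definition ptone (X G : Type) (e : G) : X -> G := fun _ => e.

(** ** Group-theoretic notions for a group H, given as a subset [S] of a
    topological space [T] (with the subspace topology) closed under [mul],
    [inv], containing [e]. *)

Definition zpow (T : Type) (mul : T -> T -> T) (inv : T -> T) (e : T)
  (x : T) (z : int) : T :=
  match z with
  | Posz n => iter n (mul x) e
  | Negz n => iter n.+1 (mul (inv x)) e
  end.

Fixpoint partial_prod (T : Type) (mul : T -> T -> T) (inv : T -> T) (e : T)
  (a : nat -> T) (z : nat -> int) (k : nat) : T :=
  match k with
  | 0 => zpow mul inv e (a 0) (z 0)
  | k'.+1 => mul (partial_prod mul inv e a z k') (zpow mul inv e (a k) (z k))
  end.

Definition absolutely_productive (T : topologicalType) (S : set T)
  (mul : T -> T -> T) (inv : T -> T) (e : T) (A : set T) : Prop :=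
  A `<=` S /\
  forall (a : nat -> T) (z : nat -> int),
    injective a -> (forall n, A (a n)) ->
    exists2 l : T, S l & partial_prod mul inv e a z @ \oo --> l.

Definition TAP (T : topologicalType) (S : set T)
  (mul : T -> T -> T) (inv : T -> T) (e : T) : Prop :=
  forall A : set T, absolutely_productive S mul inv e A -> finite_set A.

Definition countable_tightness (T : topologicalType) (S : set T) : Prop :=
  forall (A : set T) (x : T), A `<=` S -> S x -> closure A x ->
    exists2 B : set T, B `<=` A & countable B /\ closure B x.

(* Main.v *)
Require Import Defs.
From HB Require Import structures.
From mathcomp Require Import all_boot all_order all_algebra.
From mathcomp Require Import all_classical all_reals all_analysis.
From mathcomp Require Import Rstruct Rstruct_topology.

(** If [X] is compact and [A] is an infinite absolutely productive set, the NSS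
    neighborhood forces a sequence of nontrivial functions [a n] of [A] to be
    point-finite: otherwise suitable exponents would keep infinitely many factors
    of a convergent product away from [e].  Choose [x n] with [a n (x n) <> e] and
    a cluster point [p0] of the [x n].  A gliding hump selects a subsequence and
    exponents whose product takes values away from [e] at the selected [x n], while
    the selected functions tend to [e] along them; the product is then discontinuous
    at any cluster point of the selected points.  Countable tightness is obtained
    from compactness of the powers of [X]: at precision [n], finitely many members
    of [A] approximate [f] on all [n]-tuples of points.

    Conversely, let [U] be a directed open cover of [X] not containing [X].  The
    constant function [g] lies in the closure of the functions equal to [e] off sets
    whose closure is inside a member of [U]; countable tightness thus extracts
    countably many such sets [V n] covering [X].  The complements of the unions of
    the first closures form a decreasing, locally finite sequence of nonempty open
    sets, and functions supported there are infinite in number and absolutely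
    productive, against TAP. *)

Set Implicit Arguments. Unset Strict Implicit. Unset Printing Implicit Defensive.
Import Order.TTheory GRing.Theory Num.Theory.
Local Open Scope classical_set_scope.

(** * Directed covers, cluster points and filters *)

Lemma compact_directed_coverP (T : topologicalType) :
  compact [set: T] <->
  forall U : set (set T), U !=set0 -> (forall O, U O -> open O) ->
    (forall O1 O2, U O1 -> U O2 -> exists2 O, U O & O1 `|` O2 `<=` O) ->
    (forall x, exists2 O, U O & O x) -> U setT.
Proof.
split=> [cT U [ O0 UO0] Uo Ud Uc | dT F FF _].
  apply: contrapT => UT.
  pose F : set_system T := [set A | exists2 O, U O & ~` O `<=` A].
  have FF : ProperFilter F.
    split.
      move=> [ O UO sO]; apply: UT; suff <- : O = setT by [].
      by rewrite -subTset => x _; apply: contrapT => /sO.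
    split; first by exists O0.
      move=> P Q [ O1 U1 s1] [ O2 U2 s2]; have [ O UO sO] := Ud _ _ U1 U2.
      exists O => // x nOx; split.
        by apply: s1 => Ox; apply: nOx; apply: sO; left.
      by apply: s2 => Ox; apply: nOx; apply: sO; right.
    by move=> P Q PQ [ O UO sO]; exists O => // x /sO /PQ.
  have [x [_ /= clx]] := cT F FF filterT.
  have [ O UO Ox] := Uc x.
  have [] := clx (~` O) O; first by exists O.
    by apply: open_nbhs_nbhs; split=> //; exact: Uo.
  by move=> y [].
(* If [F] has no cluster point, the open sets whose complement lies in [F] form a directed cover, so
   [F] contains the empty set. *)
apply: contrapT => ncl.
suff : [set O : set T | open O /\ F (~` O)] setT.
  by move=> [_]; rewrite setCT; exact: filter_not_empty.
apply: dT.
- by exists set0; split; [exact: open0 | rewrite setC0; exact: filterT].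
- by move=> O [].
- move=> O1 O2 [ o1 F1] [ o2 F2]; exists (O1 `|` O2) => //; split; first exact: openU.
  by rewrite setCU; exact: filterI.
- move=> x; apply: contrapT => nO; apply: ncl; exists x; split=> // A B FA.
  rewrite nbhsE => -[ O [ oO Ox] OB]; apply: contrapT => nAB; apply: nO.
  exists O => //; split=> //; apply: filterS FA => y Ay Oy.
  by apply: nAB; exists y; split=> //; exact: OB.
Qed.

Lemma compact_seq_cluster (T : topologicalType) (u : nat -> T) :
  compact [set: T] ->
  exists x : T, forall O, nbhs x O -> forall N, exists2 n, (N <= n)%N & O (u n).
Proof.
move=> cT; have [x [_ clx]] := cT (u @ \oo) _ filterT.
exists x => O xO N; have [|_ [[n Nn <-] On]] := clx (u @` [set n | (N <= n)%N]) O _ xO.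
  by exists N => // n Nn /=; exists n.
by exists n.
Qed.

Lemma filter_forall_lt (T : Type) (F : set_system T) (P : nat -> T -> Prop) n :
  Filter F -> (forall i, F (P i)) -> F [set t | forall i, (i < n)%N -> P i t].
Proof.
move=> FF FP; elim: n => [|n IH]; first by apply: filterS filterT.
apply: filterS2 IH (FP n) => t Pl Pn i; rewrite ltnS leq_eqVlt => /orP[/eqP->//|].
exact: Pl.
Qed.

(** * Neighborhoods and convergence in [C_p(X,G)] *)

Lemma Cp_eval_nbhs (X G : topologicalType) (f : X -> G) x W :
  Cp_set X G f -> nbhs (f x) W ->
  nbhs (f : Cp_space X G) [set h : Cp_space X G | W (h x)].
Proof.
move=> cf xW; rewrite /nbhs /= -nbhs_subspace_in //.
have nW : nbhs (f : {ptws X -> G}) [set h | W (h x)].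
  exact: (@proj_continuous X (fun _ => G) x f _ xW).
rewrite /within /=.
by apply: (@filterS _ _ (nbhs_filter (f : {ptws X -> G})) _ _ _ nW) => h Wh _.
Qed.

Lemma ptws_nbhs_basis (X G : topologicalType) (f : {ptws X -> G}) U :
  nbhs f U -> exists (s : seq X) (W : X -> set G),
    (forall x, nbhs (f x) (W x)) /\
    forall h : X -> G, (forall x, x \in s -> W x (h x)) -> U h.
Proof.
(* The topology is a supremum over the coordinates: once the supersets of finite boxes form a filter
   [F], its convergence to [f] can be tested one coordinate at a time. *)
pose F : set_system {ptws X -> G} := [set U | exists (s : seq X) (W : X -> set G),
    (forall x, nbhs (f x) (W x)) /\
    forall h : X -> G, (forall x, x \in s -> W x (h x)) -> U h].
have FF : Filter F.
  split.
  - by exists [::], (fun _ => setT); split=> // x; exact: filterT.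
  - move=> P Q [s1 [W1 [n1 s1P]]] [s2 [W2 [n2 s2Q]]].
    exists (s1 ++ s2), (fun x => W1 x `&` W2 x); split=> [x|h hs].
      exact: filterI.
    by split; [apply: s1P | apply: s2Q] => x xs;
      have [] := hs x; rewrite // mem_cat xs ?orbT.
  - move=> P Q PQ [s [W [n sP]]]; exists s, W; split=> // h /sP; exact: PQ.
suff : F --> f by apply.
apply/cvg_sup => x A [B [[V oV VB] Bf BA]].
exists [:: x], (fun y => [set z | y = x -> V z]); split=> [y|h hx].
  have [yx|yx] := pselect (y = x); last by apply: filterS filterT => z _ /yx.
  subst y; have fV : nbhs (f x) V by apply: open_nbhs_nbhs; move: Bf; rewrite -VB.
  by apply: filterS fV => z Vz _.
by apply: BA; rewrite -VB; apply: (hx x) => //; rewrite inE.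
Qed.

Lemma Cp_nbhs_basis (X G : topologicalType) (f : X -> G) U :
  Cp_set X G f -> nbhs (f : Cp_space X G) U -> exists (s : seq X) (W : X -> set G),
    (forall x, nbhs (f x) (W x)) /\
    forall h : X -> G, Cp_set X G h -> (forall x, x \in s -> W x (h x)) -> U h.
Proof.
move=> cf; rewrite /nbhs /= -nbhs_subspace_in // => /ptws_nbhs_basis[s [W [nW sW]]].
by exists s, W; split=> // h ch /sW; apply.
Qed.

Lemma Cp_cvgP (X G : topologicalType) (u : nat -> Cp_space X G) (l : Cp_space X G) :
  (forall n, Cp_set X G (u n)) -> Cp_set X G l ->
  u @ \oo --> l <-> forall x, (u n : X -> G) x @[n --> \oo] --> (l : X -> G) x.
Proof.
move=> cu cl; split=> [ul x W xW|ul U]; first exact: (ul _ (Cp_eval_nbhs cl xW)).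
move=> /(Cp_nbhs_basis cl)[s [W [nW sW]]].
suff : \forall n \near \oo, forall x, x \in s -> W x ((u n : X -> G) x).
  by apply: filterS => n; exact: sW.
elim: s {sW} => [|x s IH]; first by apply: filterS filterT.
apply: filterS2 IH (ul x _ (nW x)) => n ns nx y; rewrite inE => /orP[/eqP->//|].
exact: ns.
Qed.

(** Reading a locally finite sequence along an injective [s] keeps it locally finite; this is the
    bound needed. *)
Lemma nat_injective_unbounded (s : nat -> nat) k :
  injective s -> exists N, forall n, (N <= n)%N -> (k <= s n)%N.
Proof.
move=> si; elim: k => [|k [N HN]]; first by exists 0.
have [[m mk]|nk] := pselect (exists m, s m = k).
  exists (maxn N m.+1) => n; rewrite geq_max => /andP[/HN kn mn].
  rewrite ltn_neqAle kn andbT; apply/eqP; rewrite -mk => /si mE.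
  by rewrite mE ltnn in mn.
exists N => n /HN kn; rewrite ltn_neqAle kn andbT; apply/eqP => kE.
by apply: nk; exists n.
Qed.

Lemma infinite_set_seq (T : Type) (A : set T) :
  infinite_set A -> exists2 a : nat -> T, injective a & forall n, A (a n).
Proof.
move=> /infiniteP/card_leP[f].
exists (fun n => val (f (to_setT n))) => [m n /val_inj mn|n]; last exact: set_valP.
have /(congr1 val) : to_setT m = to_setT n by apply: (@inj _ _ _ f) mn; rewrite inE.
by [].
Qed.

(** * Powers and partial products in a topological group *)

Section TopologicalGroup.
Context (G : topologicalType) (mul : G -> G -> G) (inv : G -> G) (e : G).
Context (HG : is_topological_group mul inv e).
Local Notation pow := (zpow mul inv e).
Local Notation prod := (partial_prod mul inv e).

Local Lemma tmulA x y z : mul x (mul y z) = mul (mul x y) z.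
Proof. by case: HG. Qed.

Local Lemma tmul1g x : mul e x = x.
Proof. by case: HG => _ /(_ x)[]. Qed.

Local Lemma tmulg1 x : mul x e = x.
Proof. by case: HG => _ /(_ x)[]. Qed.

Local Lemma tmulVg x : mul (inv x) x = e.
Proof. by case: HG => _ _ /(_ x)[]. Qed.

Local Lemma tmulgV x : mul x (inv x) = e.
Proof. by case: HG => _ _ /(_ x)[]. Qed.

Local Lemma tmulKg x y : mul (inv x) (mul x y) = y.
Proof. by rewrite tmulA tmulVg tmul1g. Qed.

Local Lemma tmulVKg x y : mul x (mul (inv x) y) = y.
Proof. by rewrite tmulA tmulgV tmul1g. Qed.

Lemma zpow_succ x (m : int) : pow x (1 + m)%R = mul x (pow x m).
Proof.
case: m => [n|[|n]]; first by rewrite -intS.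
  by rewrite /= tmulg1 tmulgV.
have -> : (1 + Negz n.+1)%R = Negz n by rewrite !NegzE intS opprD addrA subrr add0r.
by rewrite /= tmulVKg.
Qed.

Lemma zpow_pred x (m : int) : pow x (m - 1)%R = mul (inv x) (pow x m).
Proof.
by have := zpow_succ x (m - 1)%R; rewrite addrC subrK => ->; rewrite tmulKg.
Qed.

Lemma zpowD x (m n : int) : pow x (m + n)%R = mul (pow x m) (pow x n).
Proof.
elim: m => [|m IH|m IH]; first by rewrite add0r tmul1g.
  by rewrite intS -addrA !zpow_succ IH tmulA.
by rewrite intS opprD [(-1 + _)%R]addrC addrAC !zpow_pred IH tmulA.
Qed.

Lemma zpow1 (m : int) : pow e m = e.
Proof. by elim: m => [|m IH|m IH] //; rewrite intS ?opprD ?[(-1 + _)%R]addrC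
  ?zpow_succ ?zpow_pred IH ?tmulg1 // -[inv e]tmul1g tmulgV. Qed.

Lemma zpow_subgroup x : is_subgroup mul inv e (range (pow x)).
Proof.
split; first by exists 0%R.
  by move=> _ _ [m _ <-] [n _ <-]; exists (m + n)%R; rewrite ?zpowD.
move=> _ [m _ <-]; exists (- m)%R => //.
have xNx : mul (pow x m) (pow x (- m)%R) = e by rewrite -zpowD subrr.
by rewrite -[LHS](tmulKg (pow x m)) xNx tmulg1.
Qed.

Lemma tmul_continuous (X : topologicalType) (f g : X -> G) :
  continuous f -> continuous g -> continuous (fun x => mul (f x) (g x)).
Proof.
case: HG => _ _ _ mc _ fc gc x.
by apply: (cvg_comp2 (fc x) (gc x)); exact: (mc (f x, g x)).
Qed.

Lemma tinv_continuous (X : topologicalType) (f : X -> G) :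
  continuous f -> continuous (fun x => inv (f x)).
Proof.
case: HG => _ _ _ _ ic fc x.
exact: (@continuous_comp _ _ _ f inv x (fc x) (ic (f x))).
Qed.

Lemma zpow_continuous (X : topologicalType) (f : X -> G) (m : int) :
  continuous f -> continuous (fun x => pow (f x) m).
Proof.
move=> fc; elim: m => [|m IH|m IH]; first by move=> x; exact: cvg_cst.
  under eq_fun => x do rewrite intS zpow_succ; exact: tmul_continuous.
under eq_fun => x do rewrite intS opprD [(-1 + _)%R]addrC zpow_pred.
by apply: tmul_continuous => //; exact: tinv_continuous.
Qed.

Lemma partial_prod_continuous (X : topologicalType) (a : nat -> X -> G) z k :
  (forall n, continuous (a n)) -> continuous (fun x => prod (a ^~ x) z k).
Proof.
move=> ac; elim: k => [|k IH] /=; first exact: zpow_continuous.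
by apply: tmul_continuous => //; exact: zpow_continuous.
Qed.

Lemma ptzpowE (X : Type) (f : X -> G) (m : int) x :
  zpow (ptmul mul) (ptinv inv) (ptone e) f m x = pow (f x) m.
Proof. by case: m => n /=; elim: n => //= n <-. Qed.

Lemma ptpartial_prodE (X : Type) (a : nat -> X -> G) z k x :
  partial_prod (ptmul mul) (ptinv inv) (ptone e) a z k x = prod (a ^~ x) z k.
Proof. by elim: k => [|k IH] /=; rewrite -ptzpowE // /ptmul IH. Qed.

Lemma partial_prod_stable (b : nat -> G) z N :
  (forall n, (N < n)%N -> b n = e) ->
  forall k, (N <= k)%N -> prod b z k = prod b z N.
Proof.
move=> be; elim=> [|k IH]; first by rewrite leqn0 => /eqP->.
rewrite leq_eqVlt => /orP[/eqP->//|Nk].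
by rewrite /= be // zpow1 tmulg1 IH.
Qed.

(** A factor is the quotient of two consecutive partial products, and these share the limit [l]. *)
Lemma partial_prod_cvg_factor (b : nat -> G) z (l : G) :
  prod b z @ \oo --> l -> pow (b n.+1) (z n.+1) @[n --> \oo] --> e.
Proof.
move=> bl; have bl1 : prod b z n.+1 @[n --> \oo] --> l.
  by move=> W /bl[N _ HN]; exists N => // n Nn; apply: HN; exact: leqW.
rewrite (_ : (fun n => _) = fun n => mul (inv (prod b z n)) (prod b z n.+1)); last first.
  by apply/funext => n /=; rewrite tmulKg.
have [_ _ _ mc ic] := HG.
have ibl : inv (prod b z n) @[n --> \oo] --> inv l by exact: (continuous_cvg _ (ic l) bl).
have := continuous2_cvg _ (mc (inv l, l)) ibl bl1.
by rewrite tmulVg; apply.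
Qed.

(** The powers of [x] form a subgroup, which would be trivial if it stayed in [U]. *)
Lemma NSS_zpow_escape (U : set G) x :
  (forall H, is_subgroup mul inv e H -> H `<=` U -> H = [set e]) ->
  x <> e -> exists m, ~ U (pow x m).
Proof.
move=> NU xe; apply: contrapT => nU; apply: xe.
have pe : range (pow x) = [set e].
  apply: (NU _ (zpow_subgroup x)) => _ [m _ <-].
  by apply: contrapT => nUm; apply: nU; exists m.
have : range (pow x) x by exists 1%R => //=; rewrite tmulg1.
by rewrite pe.
Qed.

(** Used with consecutive partial products [u] and [v]: if both lie in [O], the factor between them
    lies in [U]. *)
Lemma left_quotient_nbhs (U : set G) : nbhs e U ->
  exists2 O : set G, open O /\ O e & forall u v, O u -> O v -> U (mul (inv u) v).
Proof.
move=> eU; have cm : continuous (fun p : G * G => mul (inv p.1) p.2).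
  apply: tmul_continuous; last by move=> p; exact: cvg_snd.
  by apply: tinv_continuous => p; exact: cvg_fst.
have : nbhs (e, e) [set p : G * G | U (mul (inv p.1) p.2)].
  by apply: (cm (e, e)) => /=; rewrite tmulVg.
move=> [[A B] /= [eA eB] AB].
exists (interior (A `&` B)); first split; first exact: open_interior.
  by apply: filterI.
move=> u v /interior_subset[Au _] /interior_subset[_ Bv].
exact: (AB (u, v)).
Qed.

Lemma metrizable_nbhs_seq : metrizable G ->
  exists W : nat -> set G, [/\ forall n, open (W n), forall n, W n e &
    forall U, nbhs e U -> exists N, forall n, (N <= n)%N -> W n `<=` U].
Proof.
move=> [d [d0 dE dC dT dN]].
exists (fun n => interior [set y | d e y < n.+1%:R^-1]%R); split.
- by move=> n; exact: open_interior.
- move=> n; apply/dN; exists (n.+1%:R^-1)%R => //.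
- move=> U /dN[eps eps0 sU].
  have [N _ HN] := near_infty_natSinv_lt (PosNum eps0).
  exists N => n Nn y /interior_subset /= dy; apply: sU => /=.
  by apply: (lt_trans dy); exact: HN.
Qed.

(** * Products in [C_p(X,G)] and locally finite families *)

Context (X : topologicalType).
Local Notation Cp := (Cp_space X G).
Local Notation CpTAP := (TAP (Cp_set X G : set Cp)
  (ptmul mul : Cp -> Cp -> Cp) (ptinv inv : Cp -> Cp) (ptone (X:=X) e : Cp)).

Lemma Cp_partial_prod_continuous (a : nat -> X -> G) z k :
  (forall n, continuous (a n)) ->
  continuous (partial_prod (ptmul mul) (ptinv inv) (ptone e) a z k).
Proof.
move=> ac; rewrite (_ : partial_prod _ _ _ _ _ _ = fun x => prod (a ^~ x) z k).
  exact: partial_prod_continuous.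
by apply/funext => x; exact: ptpartial_prodE.
Qed.

Lemma Cp_partial_prod_cvgP (a : nat -> Cp) z (l : Cp) :
  (forall n, Cp_set X G (a n)) -> Cp_set X G l ->
  (partial_prod (ptmul mul : Cp -> Cp -> Cp) (ptinv inv : Cp -> Cp)
     (ptone (X:=X) e : Cp) a z @ \oo --> l) <->
  forall x, prod (fun n => (a n : X -> G) x) z @ \oo --> (l : X -> G) x.
Proof.
move=> ac lc; rewrite Cp_cvgP //; last by move=> n; exact: Cp_partial_prod_continuous.
suff pE x : (fun n => partial_prod (ptmul mul) (ptinv inv) (ptone e) a z n x) =
    prod (fun n => (a n : X -> G) x) z.
  by split=> h x; have := h x; rewrite pE.
by apply/funext => n; exact: ptpartial_prodE.
Qed.

Lemma locally_finite_partial_prod_cvg (a : nat -> X -> G) z :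
  (forall n, continuous (a n)) ->
  (forall x : X, exists N, \forall y \near x, forall n, (N < n)%N -> a n y = e) ->
  exists2 l : X -> G, continuous l & forall x, prod (a ^~ x) z @ \oo --> l x.
Proof.
move=> ac /choice[N HN]; exists (fun x => prod (a ^~ x) z (N x)) => [x|x].
  (* The stage [N y] may vary with [y], so it is compared with [N x] at their maximum, where both
     products have stabilized. *)
  have lE : \forall y \near x, prod (a ^~ y) z (N y) = prod (a ^~ y) z (N x).
    apply: filterS (HN x) => y yN.
    rewrite -(partial_prod_stable z (nbhs_singleton (HN y)) (leq_maxl (N y) (N x))).
    by rewrite -(partial_prod_stable z yN (leq_maxr (N y) (N x))).
  move=> W xW; have := @partial_prod_continuous _ a z (N x) ac x W xW.
  by apply: filterS2 lE => y /= ->.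
move=> W /nbhs_singleton xW; exists (N x) => // n /= Nn.
by rewrite (partial_prod_stable z (nbhs_singleton (HN x)) Nn).
Qed.

Lemma locally_finite_notTAP (f : nat -> X -> G) (x : nat -> X) :
  (forall n, continuous (f n)) -> (forall n, f n (x n) <> e) ->
  (forall y : X, exists N, \forall u \near y, forall n, (N <= n)%N -> f n u = e) ->
  ~ CpTAP.
Proof.
move=> fc fx fN /(_ (range f)) tap.
have {tap}finf : finite_set (range f).
  apply: tap; split=> [_ [n _ <-]|a z ainj af]; first exact: fc.
  have ac n : Cp_set X G (a n) by have [m _ <-] := af n; exact: fc.
  have [s fs] : {s : nat -> nat & forall n, f (s n) = a n}.
    by apply: (@choice _ _ (fun n m => f m = a n)) => n; have [m _ <-] := af n; exists m.
  have sinj : injective s by move=> m n mn; apply: ainj; rewrite -!fs mn.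
  have [|l lc al] := @locally_finite_partial_prod_cvg a z ac.
    move=> y; have [N HN] := fN y.
    have [M HM] := nat_injective_unbounded N sinj.
    exists M; apply: filterS HN => u uN n Mn.
    by rewrite -fs uN // HM // ltnW.
  exists l; first exact: lc.
  exact: (Cp_partial_prod_cvgP z ac lc).2.
(* Each function occurs at finitely many indices: [f n] differs from [e] at [x n], where almost all
   [f m] equal [e]. A finite range would make [nat] finite. *)
suff : finite_set [set: nat] by exact: infinite_nat.
apply: (@sub_finite_set _ _ (\bigcup_(h in range f) (f @^-1` [set h]))).
  by move=> n _; exists (f n) => //; exists n.
apply: bigcup_finite => // _ [n _ <-].
have [N /nbhs_singleton HN] := fN (x n).
apply: (sub_finite_set _ (finite_II N)) => m /= mn.
rewrite ltnNge; apply/negP => /HN fme; apply: (fx n).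
by rewrite -mn.
Qed.

(** * TAP and countable tightness imply compactness *)

Lemma Gstar_regular_shrink : hausdorff_space G -> Gstar_regular e X ->
  forall (O : set X) x, open O -> O x -> exists V, [/\ open V, V x & closure V `<=` O].
Proof.
move=> hG [g ge reg] O x oO Ox.
have [||f [fc fx fO]] := reg (~` O) x; [exact: open_closedC | by apply |].
(* Disjoint neighborhoods of [g] and [e] pull back along [f] to a neighborhood of [x] and one of the
   complement of [O]. *)
move: hG; rewrite open_hausdorff => /(_ g e); case; first exact/eqP.
move=> [A B] /= [gA eB] [oA oB AB]; exists (f @^-1` A); split.
- by move/continuousP: fc; apply.
- by rewrite /= fx -inE.
move=> y clAy; apply: contrapT => nOy.
have fy : f y = e by apply: fO; exists y.
have [|u [/= Au Bu]] := clAy (f @^-1` B).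
  apply: open_nbhs_nbhs; split; first by move/continuousP: fc; apply.
  by rewrite /= fy -inE.
by have : (A `&` B) (f u) by []; rewrite (eqP AB).
Qed.

(** Induction on [s]: the new point gets a function that is [e] off a small [V], the old ones a
    function that is [e] on [closure V]. At each listed point one factor is [g] and the other
    [e]. *)
Lemma Gstar_regular_finite_separation (g : G) :
  hausdorff_space X ->
  (forall (O : set X) x, open O -> O x -> exists V, [/\ open V, V x & closure V `<=` O]) ->
  (forall (F : set X) (x : X), closed F -> ~ F x ->
      exists f : X -> G, [/\ continuous f, f x = g & f @` F `<=` [set e]]) ->
  forall (s : seq X) (O : set X), open O -> (forall x, x \in s -> O x) ->
  exists h : X -> G, [/\ continuous h, forall x, x \in s -> h x = g &
    forall y, ~ O y -> h y = e].
Proof.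
move=> hX shrink reg; elim=> [|x s IH] O oO sO.
  by exists (fun _ => e); split=> // x; exact: cvg_cst.
have Ox : O x by apply: sO; rewrite mem_head.
have {}sO y : y \in s -> O y by move=> ys; apply: sO; rewrite inE ys orbT.
have [xs|xs] := boolP (x \in s).
  have [h [hc hs hO]] := IH O oO sO; exists h; split=> // y.
  by rewrite inE => /orP[/eqP->|]; exact: hs.
have sclosed : closed [set` s].
  by apply: (accessible_finite_set_closed.1 (hausdorff_accessible hX)); exact: finite_seq.
have [||V [oV Vx VO]] := shrink (O `&` ~` [set` s]) x.
- by apply: openI => //; exact: closed_openC.
- by split=> //=; exact/negP.
have [||h [hc hs hO]] := IH (O `&` ~` closure V).
- by apply: openI => //; apply: closed_openC; exact: closed_closure.
- by move=> y ys; split; [exact: sO | move=> /VO[_]; apply].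
have [||f [fc fx fV]] := reg (~` V) x; [exact: open_closedC | by apply |].
have {}fV y : ~ V y -> f y = e by move=> Vy; apply: fV; exists y.
exists (fun y => mul (f y) (h y)); split; first exact: tmul_continuous.
  move=> y; rewrite inE => /orP[/eqP->|ys].
    by rewrite fx hO ?tmulg1 // => -[_]; apply; exact: subset_closure.
  by rewrite hs // fV ?tmul1g // => /subset_closure/VO[_]; apply.
move=> y Oy; rewrite hO ?tmulg1 => [|[]//].
by apply: fV => /subset_closure/VO[].
Qed.

Lemma compact_of_TAP_countable_tightness :
  hausdorff_space G -> hausdorff_space X -> Gstar_regular e X ->
  CpTAP -> countable_tightness (Cp_set X G : set Cp) -> compact [set: X].
Proof.
move=> hG hX regX tap tight; have shrink := Gstar_regular_shrink hG regX.
have [g ge reg] := regX.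
have sep := Gstar_regular_finite_separation hX shrink reg.
apply/compact_directed_coverP => U [ O0 UO0] Uo Ud Uc; apply: contrapT => UT.
pose small V := open V /\ exists2 O, U O & closure V `<=` O.
pose A : set Cp := [set h : Cp | Cp_set X G h /\
  exists V, small V /\ forall y, ~ V y -> (h : X -> G) y = e].
have gc : Cp_set X G (fun _ => g) by move=> x; exact: cvg_cst.
have clA : closure A ((fun _ => g) : Cp).
  move=> B /(Cp_nbhs_basis gc)[s [W [nW sB]]].
  have [V sV Vs] : exists2 V, small V & forall x, x \in s -> V x.
    elim: s {sB} => [|x s [V [oV [ O UO VO]] Vs]].
      exists set0 => //; split; first exact: open0.
      by exists O0; rewrite ?closure0.
    have [ O' UO' O'x] := Uc x.
    have [V' [oV' V'x V'O']] := shrink O' x (Uo _ UO') O'x.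
    exists (V `|` V').
      split; first exact: openU.
      have [ O'' UO'' sO''] := Ud _ _ UO UO'; exists O'' => //.
      rewrite closureU; apply: subset_trans sO''; exact: setUSS.
    by move=> y; rewrite inE => /orP[/eqP->|/Vs]; [right | left].
  have [h [hc hs hV]] := sep s V sV.1 Vs.
  exists h; split; first by split=> //; exists V.
  by apply: sB => // x /hs ->; exact: nbhs_singleton.
have [|B BA [Bcount clB]] := tight A ((fun _ => g) : Cp) _ gc clA.
  by move=> h [].
have [h0 [Bh0 _]] := clB setT filterT.
(* [B] is enumerated by inverting an injection into [nat]; indices outside its image are sent to
   [h0]. *)
have [b Bb bB] : exists2 b : nat -> Cp, forall n, B (b n) & forall h, B h -> exists n, b n = h.
  have /countable_injP[i iinj] := Bcount.
  have iB n : exists h : Cp, B h /\ forall h', B h' -> i h' = n -> h' = h.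
    have [[h [Bh hn]]|nh] := pselect (exists h, B h /\ i h = n).
      by exists h; split=> // h' Bh' h'n; apply: iinj; rewrite ?inE ?hn.
    by exists h0; split=> // h' Bh' h'n; exfalso; apply: nh; exists h'.
  have [b Hb] := choice iB.
  exists b => [n|h Bh]; first exact: (Hb n).1.
  by exists (i h); rewrite [RHS]((Hb (i h)).2 h).
have [V HV] : {V : nat -> set X & forall n, small (V n) /\
    forall y, ~ V n y -> (b n : X -> G) y = e}.
  by apply: (@choice _ _ (fun n V => small V /\ forall y, ~ V y -> (b n : X -> G) y = e))
    => n; have [] := BA _ (Bb n).
(* Near the constant [g] some [b n] differs from [e] at [x], which forces [x] into [V n]. *)
have Vcover x : exists n, V n x.
  have gx : nbhs g (~` [set e]).
    apply: open_nbhs_nbhs; split=> //; apply: closed_openC.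
    by apply: accessible_closed_set1; exact: hausdorff_accessible.
  have [h [/bB[n <-] bx]] := clB _ (Cp_eval_nbhs (x := x) gc gx).
  by exists n; apply: contrapT => /(HV n).2.
(* By directedness [K n] lies in a single member of [U], so it misses some point [x n]. *)
pose K n := \bigcup_(k in `I_n.+1) closure (V k).
have Kclosed n : closed (K n).
  by apply: closed_bigcup; [exact: finite_II | move=> k _; exact: closed_closure].
have KU n : exists2 O, U O & K n `<=` O.
  elim: n => [|n [ O UO KO]].
    have [[_ [ O UO VO]] _] := HV 0; exists O => // y [k /=].
    by rewrite ltnS leqn0 => /eqP->; exact: VO.
  have [[_ [ O' UO' VO']] _] := HV n.+1.
  have [ O'' UO'' sO''] := Ud _ _ UO UO'; exists O'' => // y [k /=].
  rewrite ltnS leq_eqVlt => /orP[/eqP->/VO'|kn ky]; first by move=> ?; apply: sO''; right.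
  by apply: sO''; left; apply: KO; exists k.
have [x xK] : {x : nat -> X & forall n, ~ K n (x n)}.
  apply: (@choice _ _ (fun n y => ~ K n y)) => n; apply: contrapT => nK.
  have [ O UO KO] := KU n; apply: UT; suff <- : O = setT by [].
  by rewrite -subTset => y _; apply: KO; apply: contrapT => Ky; apply: nK; exists y.
have [f Hf] : {f : nat -> X -> G & forall n,
    [/\ continuous (f n), f n (x n) = g & f n @` K n `<=` [set e]]}.
  apply: (@choice _ _ (fun n (f : X -> G) =>
    [/\ continuous f, f (x n) = g & f @` K n `<=` [set e]])) => n.
  exact: reg.
apply: (@locally_finite_notTAP f x _ _ _ tap) => [n|n|y].
- by have [] := Hf n.
- by have [_ -> _] := Hf n.
(* The open set [V m] around [y] lies in [K n] for all [n >= m], and there [f n] is [e]. *)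
- have [m Vy] := Vcover y; exists m.
  have : nbhs y (V m) by apply: open_nbhs_nbhs; split=> //; exact: (HV m).1.1.
  apply: filterS => u Vu n mn; have [_ _] := Hf n; apply; exists u => //.
  by exists m => //; exact: subset_closure.
Qed.

(** * Compactness implies countable tightness *)

Local Notation XN := (prod_topology (fun _ : nat => X)).

Lemma compact_countable_tightness :
  inhabited X -> metrizable G -> compact [set: X] ->
  countable_tightness (Cp_set X G : set Cp).
Proof.
move=> [x0] mG cX A f AC fc clA.
have [W [Wo We WN]] := metrizable_nbhs_seq mG.
(* Tuples are represented by whole sequences, of which only the first [n] terms are read; one
   compact product then serves every [n]. *)
pose close n (h : X -> G) (p : nat -> X) :=
  forall i, (i < n)%N -> W n (mul (inv (f (p i))) (h (p i))).
have close_nbhs n (h : X -> G) (p : XN) :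
    continuous h -> close n h p -> nbhs p [set q : XN | close n h q].
  move=> hc hp.
  suff pn : nbhs p [set q : XN |
      forall i, (i < n)%N -> (i < n)%N -> W n (mul (inv (f (q i))) (h (q i)))].
    by apply: filterS pn => q qi i ilt; exact: qi.
  apply: (@filter_forall_lt _ (nbhs p)
    (fun i (q : XN) => (i < n)%N ->
      W n (mul (inv (f (q i))) (h (q i))))) => i.
  have [ilt|ige] := ltnP i n; last by apply: filterS filterT.
  have Wn : nbhs (mul (inv (f (p i))) (h (p i))) (W n).
    by apply: open_nbhs_nbhs; split=> //; exact: hp.
  have qc : continuous (fun x => mul (inv ((f : X -> G) x)) (h x)).
    by apply: tmul_continuous => //; exact: tinv_continuous.
  have pn : nbhs p [set q : XN |
      W n (mul (inv (f (q i))) (h (q i)))].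
    exact: (@proj_continuous _ (fun _ : nat => X) i p _ (qc (p i) _ Wn)).
  by apply: filterS pn.
have Bn n : exists2 B : set Cp, finite_set B /\ B `<=` A &
    forall p, exists2 h : Cp, B h & close n h p.
  have cXN : compact [set: XN].
    have := @tychonoff _ (fun _ : nat => X) (fun _ => setT) (fun _ => cX).
    by congr (compact _); rewrite -subTset.
  pose U (O : set XN) := open O /\
    exists2 B : set Cp, finite_set B /\ B `<=` A &
      forall p, O p -> exists2 h : Cp, B h & close n h p.
  suff [_ [B BA HB]] : U setT by exists B => // p; exact: HB.
  apply: ((compact_directed_coverP _).1 cXN).
  - exists set0; split; first exact: open0.
    by exists set0 => //; split=> //; exact: finite_set0.
  - by move=> O [].
  - move=> O1 O2 [ o1 [B1 [f1 s1] H1]] [ o2 [B2 [f2 s2] H2]].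
    exists (O1 `|` O2) => //; split; first exact: openU.
    exists (B1 `|` B2); first by split; rewrite ?finite_setU // subUset.
    by move=> p [/H1[h]|/H2[h]] Bh hp; exists h => //; [left | right].
  (* A member of [A] close to [f] at the first [n] terms of [p] remains so for all sequences near
     [p], by continuity. *)
  - move=> p.
    have [|h [Ah hp]] := clA [set h : Cp | close n h p].
      apply: (@filter_forall_lt _ (nbhs (f : Cp))
        (fun i (h : Cp) => W n (mul (inv ((f : X -> G) (p i))) ((h : X -> G) (p i))))) => i.
      apply: (Cp_eval_nbhs (x := p i) (W := fun y => W n (mul (inv ((f : X -> G) (p i))) y)) fc).
      have lc : continuous (fun y => mul (inv ((f : X -> G) (p i))) y).
        by apply: tmul_continuous => y //; exact: cvg_cst.
      apply: lc; apply: open_nbhs_nbhs; rewrite tmulVg; split; [exact: Wo | exact: We].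
    exists (interior [set q : XN | close n h q]); last first.
      by apply: close_nbhs => //; exact: AC.
    split; first exact: open_interior.
    exists [set h]; first by split; [exact: finite_set1 | move=> _ ->].
    by move=> q /interior_subset hq; exists h.
have [B HB] := choice (fun n => let: ex_intro2 B b1 b2 := Bn n in ex_intro _ B (conj b1 b2)).
exists (\bigcup_n B n); first by move=> h [n _ Bh]; have [[_ +] _] := HB n; apply.
split.
  apply: bigcup_countable => // n _; apply: finite_set_countable.
  by have [[]] := HB n.
move=> O /(Cp_nbhs_basis fc)[s [V [nV sO]]].
have [N HN] : exists N, forall x, x \in s -> forall n, (N <= n)%N ->
    forall u, W n u -> V x (mul ((f : X -> G) x) u).
  elim: s {sO} => [|x s [N HN]]; first by exists 0.
  have xV : nbhs e [set u | V x (mul ((f : X -> G) x) u)].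
    have lc : continuous (fun y => mul ((f : X -> G) x) y).
      by apply: tmul_continuous => y //; exact: cvg_cst.
    by apply: lc; rewrite tmulg1.
  have [M HM] := WN _ xV; exists (maxn N M) => y; rewrite inE => ys n.
  rewrite geq_max => /andP[Nn Mn]; move: ys => /orP[/eqP->|ys].
    exact: HM.
  exact: HN.
(* The sequence lists [s] and continues with [x0]. The maximum makes [W] small enough and the tuple
   long enough to contain [s]. *)
have [_ /(_ (nth x0 s))[h Bh hp]] := HB (maxn N (size s)).
have [[_ BA] _] := HB (maxn N (size s)).
exists h; split; first by exists (maxn N (size s)).
apply: sO; first by apply: AC; exact: BA.
move=> x xs; rewrite -(tmulVKg (f x) (h x)).
apply: (HN _ xs _ (leq_maxl N (size s))).
have := hp (index x s). rewrite nth_index //; apply.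
by rewrite leq_max index_mem xs orbT.
Qed.

(** * Compactness implies TAP *)

Lemma compact_TAP :
  hausdorff_space G -> metrizable G -> NSS mul inv e -> compact [set: X] -> CpTAP.
Proof.
move=> hG mG [U [Uo Ue NU]] cX A [AC prodA]; apply: contrapT => Ainf.
have eU : nbhs e U by exact: open_nbhs_nbhs.
have [a ainj aA] : exists2 a : nat -> Cp, injective a &
    forall n, A (a n) /\ a n <> ptone (X:=X) e.
  have [|a ainj aA] := @infinite_set_seq _ (A `\` [set (ptone (X:=X) e : Cp)]).
    by apply: infinite_setD => //; exact: finite_set1.
  by exists a => // n; have [] := aA n.
have ac n : continuous (a n : X -> G) by apply: AC; exact: (aA n).1.
have [x ax] : {x : nat -> X & forall n, (a n : X -> G) (x n) <> e}.
  apply: (@choice _ _ (fun n y => (a n : X -> G) y <> e)) => n.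
  apply: contrapT => nex; apply: (aA n).2; apply/funext => y.
  by apply: contrapT => ay; apply: nex; exists y.
have [zesc zescP] : {z : G -> int & forall u, u <> e -> ~ U (pow u (z u))}.
  apply: (@choice _ _ (fun u z => u <> e -> ~ U (pow u z))) => u.
  have [->|ue] := pselect (u = e); first by exists 0%R.
  by have [m Um] := NSS_zpow_escape NU ue; exists m.
(* The exponents are chosen for this [y], so that every factor other than [e] leaves [U];
   convergence allows only finitely many of these. *)
have point_finite (y : X) : \forall n \near \oo, (a n : X -> G) y = e.
  have [l lc al] := prodA a (fun n => zesc ((a n : X -> G) y)) ainj (fun n => (aA n).1).
  have := (Cp_partial_prod_cvgP _ ac lc).1 al y.
  move=> /partial_prod_cvg_factor/(_ U eU)[N _ HN].
  exists N.+1 => // -[//|n] /= Nn; apply: contrapT => ne.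
  exact: zescP ne (HN n Nn).
have [K KP] : {K : nat -> nat & forall n m, (K n <= m)%N ->
    forall j, (j < n.+1)%N -> (a m : X -> G) (x j) = e}.
  apply: (@choice _ _ (fun n k => forall m, (k <= m)%N ->
    forall j, (j < n.+1)%N -> (a m : X -> G) (x j) = e)) => n.
  have [N _ HN] := filter_forall_lt n.+1 _ (fun j => point_finite (x j)).
  by exists N => m Nm; exact: HN.
have [p0 clp0] := compact_seq_cluster x cX.
have [M _ HM] := point_finite p0.
have [ O [Oo Oe] OU] := left_quotient_nbhs eU.
have [W [Wo We WN]] := metrizable_nbhs_seq mG.
(* All [a j] with [j >= M] equal [e] at [p0], so finitely many of them can be kept in [W n] near
   [p0]. *)
pose tame n := [set y : X | forall j, (j < n.+1)%N -> (M <= j)%N -> W n ((a j : X -> G) y)].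
have tame_nbhs n : nbhs p0 (tame n).
  apply: (@filter_forall_lt _ (nbhs p0)
    (fun j y => (M <= j)%N -> W n ((a j : X -> G) y))) => j.
  have [Mj|jM] := leqP M j; last by apply: filterS filterT.
  have Wj : nbhs ((a j : X -> G) p0) (W n).
    by apply: open_nbhs_nbhs; rewrite HM //; split.
  have pW : nbhs p0 [set y | W n ((a j : X -> G) y)] by exact: (ac j p0 _ Wj).
  by apply: filterS pW.
pose good (s : nat * int * (X -> G)) := continuous s.2 /\ s.2 p0 = e.
(* A state holds the last selected index, its exponent, and the product of the
   factors selected so far; the base point [p0] keeps that product equal to [e]. *)
pose next (s t : nat * int * (X -> G)) := (M <= s.1.1)%N -> good s ->
  [/\ (s.1.1 < t.1.1)%N /\ (K s.1.1 <= t.1.1)%N, tame s.1.1 (x t.1.1),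
      O (s.2 (x t.1.1)), ~ U (pow ((a t.1.1 : X -> G) (x t.1.1)) t.1.2) &
      t.2 = fun y => mul (s.2 y) (pow ((a t.1.1 : X -> G) y) t.1.2)].
have next_ex s : {t | next s t}.
  apply: cid; have [[Ms [sc s0]]|nMs] := pselect ((M <= s.1.1)%N /\ good s); last first.
    by exists s => Ms gs; exfalso; exact: nMs.
  have pO : nbhs p0 (tame s.1.1 `&` s.2 @^-1` O).
    apply: filterI => //; apply: sc; rewrite s0; exact: open_nbhs_nbhs.
  have [n + [tn On]] := clp0 _ pO (maxn s.1.1.+1 (K s.1.1)).
  rewrite geq_max => /andP[sn Kn].
  pose z := zesc ((a n : X -> G) (x n)).
  exists (n, z, fun y => mul (s.2 y) (pow ((a n : X -> G) y) z)) => _ _.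
  by split=> //; exact: zescP.
have [s [s0 sS]] := dependent_choice next_ex (M, 0%R, fun _ => e).
have sgood k : (M <= (s k).1.1)%N /\ good (s k).
  elim: k => [|k [Mk gk]].
    by rewrite s0; split=> //; split=> // y; exact: cvg_cst.
  have [[lt_k _] _ _ _ pS] := sS k Mk gk; have [kc k0] := gk; split.
    by apply: (leq_trans Mk); exact: ltnW.
  rewrite /good pS k0 tmul1g HM ?zpow1 //; last by apply: (leq_trans Mk); exact: ltnW.
  split=> //; apply: tmul_continuous => //; exact: zpow_continuous.
(* The initial state has index [M] but contributes no factor, so the selection starts at [s 1]. *)
pose n_ k := (s k.+1).1.1; pose z_ k := (s k.+1).1.2.
have step k := sS k (sgood k).1 (sgood k).2.
have slt : {homo (fun k => (s k).1.1) : i j / (i < j)%N}.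
  apply: homo_ltn => [i j k|k]; first exact: ltn_trans.
  by have [[]] := step k.
have n_lt i j : (i < j)%N -> (n_ i < n_ j)%N by exact: (slt i.+1 j.+1).
have sle : {homo (fun k => (s k).1.1) : i j / (i <= j)%N}.
  by move=> i j; rewrite leq_eqVlt => /orP[/eqP->//|/slt/ltnW].
have k_le_s k : (k <= (s k).1.1)%N.
  by elim: k => [//|k IH]; exact: leq_ltn_trans IH (slt _ _ (ltnSn k)).
pose b (y : X) k := (a (n_ k) : X -> G) y.
have prodE k y : prod (b y) z_ k = (s k.+1).2 y.
  elim: k => [|k IH].
    by have [_ _ _ _ ->] := step 0; rewrite s0 /= tmul1g.
  by have [_ _ _ _ ->] := step k.+1; rewrite /= IH.
have [l lc al] : exists2 l : X -> G, continuous l &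
    forall y, prod (b y) z_ @ \oo --> l y.
  have [||l lc al] := prodA (fun k => a (n_ k)) z_.
  - move=> i j /ainj nij; have [ij|ji|//] := ltngtP i j.
      by have := n_lt i j ij; rewrite nij ltnn.
    by have := n_lt j i ji; rewrite nij ltnn.
  - by move=> k; exact: (aA _).1.
  exists l => // y.
  exact: (Cp_partial_prod_cvgP _ (fun k => ac (n_ k)) lc).1 al y.
have lE N y : (forall k, (N < k)%N -> b y k = e) -> l y = prod (b y) z_ N.
  move=> be; apply: (cvg_unique _ (al y)) => //; apply: cvg_near_cst.
  by exists N => // k /= Nk; rewrite (partial_prod_stable z_ be Nk).
(* By the choice of [K], all later factors are [e] at [x (n_ k)], so [l] is there the product up to
   [k]. The product before the last factor lies in [O]; were [l] in [O] too, that factor would lie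
   in [U]. *)
have nOl k : ~ O (l (x (n_ k))).
  rewrite (lE k) => [Ol|i ki]; last first.
    have [[_ Ki] _ _ _ _] := step i; apply: (KP _ _ Ki).
    by rewrite ltnS; exact: sle.
  have [_ _ Ok nUk pS] := step k; apply: nUk.
  move: Ol; rewrite prodE pS => Ol; have := OU _ _ Ok Ol.
  by rewrite tmulKg.
have [q clq] := compact_seq_cluster (x \o n_) cX.
(* Tameness puts the [j]-th selected function in ever smaller [W] along the later selected points,
   hence it is [e] at their cluster point [q]. *)
have bq j : b q j = e.
  apply: hG => V V' qV /WN[N HN].
  have [k + Vk] := clq _ (ac (n_ j) q _ qV) (maxn j.+1 N).
  rewrite geq_max => /andP[jk Nk].
  exists (b (x (n_ k)) j); split=> //.
  apply: (HN (s k).1.1); first exact: leq_trans (k_le_s k).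
  have [_ tk _ _ _] := step k; apply: tk; first by rewrite ltnS; exact: sle.
  exact: (sgood j.+1).1.
(* Now [l] is [e] at [q], so continuity puts it in [O] at some selected point, against [nOl]. *)
have lq : l q = e by rewrite (lE 0) //= bq zpow1.
have [|k _ /nOl//] := clq (l @^-1` O) _ 0.
by apply: lc; rewrite lq; exact: open_nbhs_nbhs.
Qed.

End TopologicalGroup.

Theorem theorem7p6
  (G : topologicalType) (mul : G -> G -> G) (inv : G -> G) (e : G)
  (HG : is_topological_group mul inv e) (HGhaus : hausdorff_space G)
  (HGmet : metrizable G) (HGnss : NSS mul inv e)
  (X : topologicalType) (HXne : inhabited X) (HXtych : tychonoff_space X)
  (HXreg : Gstar_regular e X) :
  compact [set: X] <->
  (TAP (Cp_set X G : set (Cp_space X G))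
       (ptmul mul : Cp_space X G -> Cp_space X G -> Cp_space X G)
       (ptinv inv : Cp_space X G -> Cp_space X G)
       (ptone (X:=X) e : Cp_space X G)
   /\ countable_tightness (Cp_set X G : set (Cp_space X G))).
Proof.
split=> [cX|[tap tight]].
  split; first exact: (compact_TAP HG HGhaus HGmet HGnss cX).
  exact: (compact_countable_tightness HG HXne HGmet cX).
exact: (compact_of_TAP_countable_tightness HG HGhaus HXtych.1 HXreg tap tight).
Qed.
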